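(* Let $k$ be a positive integer. For the groups $\mathbb{Z}_{3n}\mathbin{\mathrm{wr}}\mathbb{Z}^{2k}$ with $n$ a positive integer, $\gcd(n,2)=1$, and $\mathbb{Z}_n\mathbin{\mathrm{wr}}\mathbb{Z}^k$ with $n$ a positive integer, $\gcd(n,6)=1$ (i.e. in all cases where $R(\varphi)$ can be finite), the finite-dimensional twisted Burnside--Frobenius theorem holds: for every automorphism $\varphi$ with $R(\varphi)<\infty$, $R(\varphi)=\#\mathrm{Fix}(\widehat{\varphi})$.
   Context: $\mathbb{Z}_q\mathbin{\mathrm{wr}}\mathbb{Z}^d=\bigoplus_{x\in\mathbb{Z}^d}(\mathbb{Z}_q)_x\rtimes\mathbb{Z}^d$ is the restricted wreath product with $\mathbb{Z}^d$ acting by shifting indices. For an automorphism $\varphi$ of a group $G$, $R(\varphi)$ is the Reidemeister number, the number of classes of the relation $g_1\sim hg_2\varphi(h^{-1})$, $h\in G$. $\widehat{G}_f$ is the set of equivalence classes of finite-dimensional irreducible unitary representations of $G$, $\widehat{\varphi}\colon[\rho]\mapsto[\rho\circ\varphi]$, and $\#\mathrm{Fix}(\widehat{\varphi})$ is the number of its fixed points. *)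

(* Defs.v *)
From mathcomp Require Import all_boot all_order all_algebra.
From mathcomp Require Import reals Rstruct complex.
Set Implicit Arguments. Unset Strict Implicit. Unset Printing Implicit Defensive.
Import GRing.Theory Num.Theory.
Local Open Scope ring_scope.

Definition C := complex Rdefinitions.R.

Definition ZD (d : nat) := 'rV[int]_d.

(** Z_q for q >= 1 (we only use q >= 1): the ordinals 'I_q with their
    additive group structure modulo q. *)
Definition Lamp (q : nat) := 'I_(q.-1).+1.

(** Carrier of the (unrestricted) wreath product: pairs (f, v) with
    f : Z^d -> Z_q and v in Z^d.  The restricted wreath product
    Z_q wr Z^d is the subset [inW] of pairs with f finitely supported. *)
Definition WT (q d : nat) := ((ZD d -> Lamp q) * ZD d)%type.

Definition inW (q d : nat) (g : WT q d) : Prop :=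
  exists s : seq (ZD d), forall x, x \notin s -> g.1 x = 0.

(** Group law: (f, v)(g, w) = (f + v.g, v + w) where (v.g)(x) = g(x - v)
    (Z^d acting by shifting indices). *)
Definition wmul (q d : nat) (g h : WT q d) : WT q d :=
  (fun x => g.1 x + h.1 (x - g.2), g.2 + h.2).
Definition wone (q d : nat) : WT q d := (fun _ => 0, 0).
Definition winv (q d : nat) (g : WT q d) : WT q d :=
  (fun x => - g.1 (x + g.2), - g.2).

(** Automorphisms of the group Z_q wr Z^d (maps defined on the carrier,
    only their behaviour on the group matters). *)
Definition is_aut (q d : nat) (phi : WT q d -> WT q d) : Prop :=
  [/\ forall g, inW g -> inW (phi g),
      forall g h, inW g -> inW h -> phi (wmul g h) = wmul (phi g) (phi h),
      forall g h, inW g -> inW h -> phi g = phi h -> g = h &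
      forall y, inW y -> exists2 x, inW x & phi x = y].

Definition twconj (q d : nat) (phi : WT q d -> WT q d) (g1 g2 : WT q d) : Prop :=
  exists2 h, inW h & g1 = wmul (wmul h g2) (phi (winv h)).

Definition reidemeister_eq (q d : nat) (phi : WT q d -> WT q d) (N : nat) : Prop :=
  exists s : seq (WT q d),
    [/\ size s = N,
        forall i, (i < N)%N -> inW (nth (wone q d) s i),
        forall i j, (i < N)%N -> (j < N)%N ->
           twconj phi (nth (wone q d) s i) (nth (wone q d) s j) -> i = j &
        forall g, inW g -> exists2 i, (i < N)%N & twconj phi g (nth (wone q d) s i)].

(** Finite-dimensional complex matrix representations (functions on the
    carrier; only values on the group matter). *)
Record frep (q d : nat) := FRep { rdim : nat; rmap : WT q d -> 'M[C]_rdim }.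

Definition unitary_mx (m : nat) (A : 'M[C]_m) : Prop :=
  A *m (map_mx Num.conj A)^T = 1%:M.

Definition irr_unitary_rep (q d : nat) (rho : frep q d) : Prop :=
  [/\ (0 < rdim rho)%N,
      forall g h, inW g -> inW h ->
        rmap rho (wmul g h) = rmap rho g *m rmap rho h,
      forall g, inW g -> unitary_mx (rmap rho g) &
      forall U : 'M[C]_(rdim rho),
        (forall g, inW g -> (U *m rmap rho g <= U)%MS) ->
        (U == 0) || row_full U].

Definition rep_equiv (q d : nat) (rho sigma : frep q d) : Prop :=
  exists e : rdim rho = rdim sigma,
  exists2 P : 'M[C]_(rdim sigma), P \in unitmx &
    forall g, inW g -> P *m castmx (e, e) (rmap rho g) = rmap sigma g *m P.

Definition rep_twist (q d : nat) (phi : WT q d -> WT q d) (rho : frep q d) : frep q d :=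
  @FRep q d (rdim rho) (fun g => rmap rho (phi g)).

Definition fix_dual_eq (q d : nat) (phi : WT q d -> WT q d) (N : nat) : Prop :=
  exists s : seq (frep q d),
    [/\ size s = N,
        forall i, (i < N)%N -> irr_unitary_rep (nth (FRep (fun _ => 0 : 'M[C]_0)) s i) /\
           rep_equiv (rep_twist phi (nth (FRep (fun _ => 0 : 'M[C]_0)) s i))
                     (nth (FRep (fun _ => 0 : 'M[C]_0)) s i),
        forall i j, (i < N)%N -> (j < N)%N ->
           rep_equiv (nth (FRep (fun _ => 0 : 'M[C]_0)) s i)
                     (nth (FRep (fun _ => 0 : 'M[C]_0)) s j) -> i = j &
        forall rho, irr_unitary_rep rho -> rep_equiv (rep_twist phi rho) rho ->
           exists2 i, (i < N)%N & rep_equiv rho (nth (FRep (fun _ => 0 : 'M[C]_0)) s i)].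

Definition TBFT_f (q d : nat) : Prop :=
  forall phi : WT q d -> WT q d, is_aut phi ->
  forall N : nat, reidemeister_eq phi N -> fix_dual_eq phi N.

(* Main.v *)
Require Import Defs.
From mathcomp Require Import all_boot all_order all_algebra.
From mathcomp Require Import cyclic separable cyclotomic boolp functions ring.
From mathcomp Require Import Rstruct complex.
(**
The lamp group A = (+) Z_q consists of the torsion elements, so phi induces an
automorphism M of Z^d, and R(phi) < oo forces det (1 - M) <> 0. The fibres of
the twisted classes over v in Z^d are governed by the cokernel of 1 - T, where
T is phi restricted to A followed by the shift by v. Modulo a prime p dividing
q, A becomes the group ring F_p[Z^d], whose units are monomials; hence T maps
the point mass at y to c times the point mass at alpha y, with alpha affine of
linear part M. If some alpha-orbit carried a nonzero T-invariant character,
dilating it about the rational fixed point of alpha would produce infinitely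
many such orbits and thus infinitely many twisted classes. So no orbit does,
1 - T is onto modulo every p, hence onto, and R(phi) is the order of
Z^d / Z^d (1 - M).

On the dual side let rho be a fixed irreducible representation and psi the
character of A on a common eigenvector of rho(A). Eigenvectors of distinct
characters are orthogonal, so fixedness yields psi = psi o T for some v, and
surjectivity of 1 - T gives psi = 1. Then rho is trivial on A, hence a character
of the finite group Z^d / Z^d (1 - M). The Smith normal form of 1 - M shows that
there are as many of these as elements.
*)
Set Implicit Arguments. Unset Strict Implicit. Unset Printing Implicit Defensive.
Import Order.TTheory GRing.Theory Num.Theory.
Local Open Scope ring_scope.

(** * Roots of unity, subspaces and common eigenvectors *)

Lemma exists_prim_root (F : numClosedFieldType) n :
  (0 < n)%N -> exists z : F, n.-primitive_root z.
Proof.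
move=> n_gt0; have [rs] := closed_field_poly_normal ('X^n - 1 : {poly F}).
rewrite (monicP (monicXnsubC _ n_gt0)) scale1r => factor.
have unity_rs : all n.-unity_root rs.
  by apply/allP => x; rewrite -root_prod_XsubC -factor.
have uniq_rs : uniq rs.
  by rewrite -separable_prod_XsubC -factor separable_Xn_sub_1 // pnatr_eq0 -lt0n.
have size_rs : size rs = n.
  by have := size_XnsubC (1 : F) n_gt0; rewrite factor size_prod_XsubC => -[].
have := has_prim_root n_gt0 unity_rs uniq_rs; rewrite size_rs leqnn.
by move=> /(_ isT)/hasP[z _ zn]; exists z.
Qed.

(** Take [U] of maximal rank among the matrices whose row space lies in [S]; adding a row of [S]
    cannot raise the rank, so that row already lies in [U]. This lets irreducibility apply to
    subspaces given by predicates. *)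
Lemma subspace_mx (F : fieldType) n (S : 'rV[F]_n -> Prop) :
    S 0 -> (forall a x y, S x -> S y -> S (a *: x + y)) ->
  exists U : 'M[F]_n, forall x : 'rV_n, (x <= U)%MS <-> S x.
Proof.
move=> S0 Slin.
pose P r := `[< exists2 U : 'M[F]_n, \rank U = r & forall x : 'rV_n, (x <= U)%MS -> S x >].
have exP : exists r, P r.
  exists 0%N; apply/asboolP; exists 0; first exact: mxrank0.
  by move=> x; rewrite submx0 => /eqP->.
have ubP r : P r -> (r <= n)%N by move=> /asboolP[U <- _]; exact: rank_leq_col.
case: (ex_maxnP exP ubP) => r /asboolP[U rU SU] maxr.
exists U => x; split=> [|Sx]; first exact: SU.
have /maxr : P (\rank (U + x)%MS).
  apply/asboolP; exists (U + x)%MS => // y /sub_addsmxP[[a b] ->] /=.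
  rewrite addrC (mx11_scalar b) mul_scalar_mx.
  by apply: Slin => //; apply: SU; apply: submxMl.
rewrite -rU => le_rk.
have := mxrank_leqif_sup (addsmxSl U x); move/geq_leqif; rewrite le_rk.
by move/esym; apply: submx_trans; apply: addsmxSr.
Qed.

(** On a nonzero common stable subspace of minimal rank, an eigenspace of one member is stable under
    all others by commutation, hence is the whole subspace. Every member is therefore scalar
    there. *)
Lemma family_common_eigenvector (F : numClosedFieldType) n (As : 'M[F]_n -> Prop) :
    (0 < n)%N -> (forall A B, As A -> As B -> comm_mx A B) ->
  exists2 v : 'rV[F]_n, v != 0 & forall A, As A -> exists a, v *m A = a *: v.
Proof.
move=> n_gt0 comAs.
pose P r := `[< exists2 U : 'M[F]_n, \rank U = r & U != 0 /\ forall A, As A -> stablemx U A >].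
have exP : exists r, P r.
  exists n; apply/asboolP; exists 1%:M; first exact: mxrank1.
  split=> [|A _]; last by rewrite mul1mx submx1.
  by rewrite -mxrank_eq0 mxrank1 -lt0n.
case: (ex_minnP exP) => r /asboolP[U rU [U0 sU]] minr.
exists (nz_row U) => [|A AsA]; first by rewrite nz_row_eq0.
pose B := row_base U; pose Cm := B *m A *m pinvmx B.
have BE : B *m A = Cm *m B.
  rewrite mulmxKpV // (submx_trans (submxMr A _) (submx_trans (sU A AsA) _)) //.
    by rewrite eq_row_base.
  by rewrite eq_row_base.
have rU_gt0 : (0 < \rank U)%N by rewrite lt0n mxrank_eq0.
have [a /eigenvalueP[w wC w0]] := eigenvalue_closed Cm rU_gt0.
pose V := (U :&: eigenspace A a)%MS.
have V0 : V != 0.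
  have wB0 : w *m B != 0.
    apply: contraNneq w0 => wB.
    by rewrite -(inj_eq (row_free_inj (row_base_free U))) wB mul0mx.
  apply: contraNneq wB0 => V0; rewrite -submx0 -V0 sub_capmx.
  rewrite (submx_trans (submxMl w B)) ?eq_row_base //=.
  by apply/eigenspaceP; rewrite -mulmxA BE mulmxA wC scalemxAl.
have /minr : P (\rank V).
  apply/asboolP; exists V => //; split=> // A' As'.
  rewrite sub_capmx (submx_trans (submxMr A' (capmxSl _ _))) ?sU //=.
  apply/eigenspaceP; rewrite -mulmxA (comAs A' A) // mulmxA.
  by rewrite (eigenspaceP (capmxSr U (eigenspace A a))) scalemxAl.
rewrite -rU => le_rk; exists a.
have := mxrank_leqif_sup (capmxSl U (eigenspace A a)); move/geq_leqif.
rewrite le_rk => /esym sUV; apply/eigenspaceP.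
by apply: (submx_trans (nz_row_sub U)); apply: (submx_trans sUV); apply: capmxSr.
Qed.

(** * Units of the group ring of Z^d *)

Lemma seq_argmax (T : eqType) (f : T -> int) (s : seq T) x0 : x0 \in s ->
  exists2 x, x \in s & forall y, y \in s -> f y <= f x.
Proof.
elim: s x0 => // a s IH x0 _; case: s IH => [_|b s IH].
  by exists a; rewrite ?mem_head // => y; rewrite inE => /eqP->.
have [x xs xmax] := IH b (mem_head _ _).
have [le_ax|lt_xa] := lerP (f a) (f x).
  by exists x; [rewrite inE xs orbT | move=> y; rewrite inE => /predU1P[->|/xmax]].
exists a; first exact: mem_head.
move=> y; rewrite inE => /predU1P[->//|/xmax le_y].
exact: le_trans le_y (ltW lt_xa).
Qed.

Lemma sum_seq_sub (V : nmodType) (T : eqType) (s t : seq T) (F : T -> V) :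
    uniq s -> uniq t -> {subset s <= t} -> (forall x, x \notin s -> F x = 0) ->
  \sum_(x <- t) F x = \sum_(x <- s) F x.
Proof.
move=> us ut st F0; rewrite (bigID (mem s)) /= [X in _ + X]big1 ?addr0; last first.
  by move=> x /F0.
rewrite -big_filter; apply: perm_big; apply: uniq_perm; rewrite ?filter_uniq //.
move=> x; rewrite mem_filter andbC; case: (boolP (x \in t)) => //= xt.
by apply/esym/negbTE; apply: contra xt; apply: st.
Qed.

(** The functional [(1, t, t^2, ...)] sends a row to the value at [t] of the polynomial with these
    coefficients, so it suffices that [t] is not a root of the product over all nonzero
    differences. *)
Lemma separating_functional d (s : seq 'rV[int]_d) :
  exists l : 'cV[int]_d, {in s &, injective (fun x => (x *m l) 0 0)}.
Proof.
pose D := [seq x - y | x <- s, y <- s].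
pose p : {poly int} := \prod_(w <- D | w != 0) rVpoly w.
have p0 : p != 0.
  rewrite prodf_seq_neq0; apply/allP => w _; apply/implyP.
  by apply: contraNneq => w0; rewrite -[w]rVpolyK w0 linear0.
have [t pt] : exists t : int, ~~ root p t.
  pose rs := [seq i%:Z | i <- iota 0 (size p)].
  case: (boolP (all (root p) rs)) => [rp|/allPn[t _ pt]]; last by exists t.
  have := max_poly_roots p0 rp; rewrite size_map size_iota ltnn.
  by rewrite map_inj_uniq ?iota_uniq => [/(_ isT)//|i j []].
exists (\col_i t ^+ i) => x y xs ys /= exy; apply/eqP; rewrite -subr_eq0.
apply: contraNT pt => w0.
have wl : (rVpoly (x - y)).[t] = 0.
  rewrite (horner_coef_wide _ (size_poly _ _)).
  have : ((x - y) *m \col_i t ^+ i) 0 0 = 0 by rewrite mulmxBl mxE [X in _ + X]mxE exy subrr.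
  rewrite mxE => wl0; rewrite -[RHS]wl0.
  by apply: eq_bigr => i _; rewrite coef_rVpoly_ord [(\col__ _) _ _]mxE.
rewrite rootE horner_prod prodf_seq_eq0; apply/hasP; exists (x - y).
  exact: allpairs_f.
by rewrite w0 wl eqxx.
Qed.

(* A product of two elements of the group ring of Z^d has a nonzero coefficient
   at the sum of the unique maxima, and at the sum of the minima, of a functional
   that is injective on the support of one factor. *)
Lemma convolution_unit_monomial (F : idomainType) d (u h : 'rV[int]_d -> F)
    (e : 'rV[int]_d -> 'rV[int]_d) (su s : seq 'rV[int]_d) :
    injective e -> uniq s -> (forall x, x \notin su -> u x = 0) ->
    (forall x, \sum_(y <- s) h y * u (x - e y) = (x == 0)%:R) ->
  exists2 v, u v != 0 & forall x, x != v -> u x = 0.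
Proof.
move=> inj_e us su0 conv.
pose S := [seq x <- su | u x != 0]; pose H := [seq y <- s | h y != 0].
have memS x : (x \in S) = (u x != 0).
  by rewrite mem_filter; case: (boolP (x \in su)) => [|/su0->]; rewrite ?andbT ?eqxx.
have [y0 [y0H x0S]] : exists y0, y0 \in H /\ - e y0 \in S.
  have /eqP : \sum_(y <- s) h y * u (0 - e y) != 0 by rewrite conv eqxx oner_eq0.
  have [/hasP[y ys]|/hasPn no_y] := boolP (has (fun y => h y * u (0 - e y) != 0) s).
    rewrite mulf_eq0 negb_or sub0r => /andP[hy uy] _; exists y.
    by rewrite mem_filter hy ys memS.
  by rewrite big_seq big1 // => y /no_y; rewrite negbK => /eqP.
have [l inj_l] := separating_functional S.
pose L (x : 'rV[int]_d) : int := (x *m l) 0 0.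
have LD : {morph L : x y / x + y} by move=> x y; rewrite /L mulmxDl mxE.
have L0 : L 0 = 0 by rewrite /L mul0mx mxE.
(* Here [x] maximizes [G] over [S] and [y] maximizes [G \o e] over [H]. Only this pair contributes
   to the coefficient at [x + e y], which is thus nonzero and forces [x + e y = 0]. *)
have extremal (G : 'rV[int]_d -> int) : {morph G : x y / x + y} -> {in S &, injective G} ->
  exists x y, [/\ x \in S, y \in H, x + e y = 0,
     forall x', x' \in S -> G x' <= G x & forall y', y' \in H -> G (e y') <= G (e y)].
  move=> GD inj_G.
  have [x xS xmax] := seq_argmax G x0S.
  have [y yH ymax] := seq_argmax (G \o e) y0H.
  exists x, y; split=> //; apply/eqP.
  have := conv (x + e y); rewrite (bigD1_seq y) //=; last first.
    by move: yH; rewrite mem_filter => /andP[].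
  rewrite addrK big1_seq ?addr0 => [|y' /andP[y'y y's]].
    case: (_ =P 0) => // _ /eqP; rewrite mulf_eq0.
    by move: yH xS; rewrite mem_filter memS => /andP[/negPf-> _] /negPf->.
  apply/eqP; apply: contraNT y'y; rewrite mulf_eq0 negb_or => /andP[hy' ux'].
  have x'S : x + e y - e y' \in S by rewrite memS.
  have le_y : G (e y') <= G (e y) by apply: ymax; rewrite mem_filter hy'.
  have Exy : x + e y - e y' + e y' = x + e y by rewrite subrK.
  have Ex : G (x + e y - e y') = G x.
    apply/eqP; rewrite eq_le xmax //= -(lerD2r (G (e y'))) -(GD (x + e y - e y')) Exy GD.
    by rewrite lerD2l.
  have /eqP := inj_G _ _ x'S xS Ex; rewrite subr_eq (inj_eq (addrI x)).
  by move/eqP/inj_e->.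
have [x1 [y1 [x1S y1H xy1 xmax ymax]]] := extremal L LD inj_l.
(* Now [L x1 + L (e y1) = 0 = L x2 + L (e y2)]. As [L (e y2) <= L (e y1)], the maximum of [L] on [S]
   is at most its minimum, so [S] is a single point. *)
have [||x2 [y2 [x2S y2H xy2 xmin ymin]]] := extremal (fun x => - L x).
- by move=> x y; rewrite LD opprD.
- by move=> x y xS yS /oppr_inj; apply: inj_l.
exists x1 => [|x]; first by rewrite -memS.
apply: contraNeq; rewrite -memS => xS; apply/eqP/inj_l => //.
apply/eqP; rewrite eq_le; apply/andP; split; first exact: xmax.
have le_x2x : L x2 <= L x by rewrite -lerN2; apply: xmin.
apply: le_trans le_x2x; rewrite -(lerD2r (L (e y2))) -[X in _ <= X]LD xy2 -xy1 LD lerD2l.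
exact: ymax.
Qed.

(* The hypothesis makes [chi y = 1] and [chi z = c * chi (f z)] consistent on the
   orbit of [y], outside of which [chi] is 0. *)
Lemma orbit_character (T : Type) (F : fieldType) (f : T -> T) (c : F) (y : T) :
    c != 0 -> (forall m n, iter m f y = iter n f y -> c ^+ m = c ^+ n) ->
  exists chi : T -> F, [/\ forall z, chi z = c * chi (f z), chi y = 1 &
    forall z, chi z != 0 -> exists m n, iter m f z = iter n f y].
Proof.
move=> c0 cy.
pose rel z a := exists m n, iter m f z = iter n f y /\ a = c ^+ m / c ^+ n.
have rel_uniq z a b : rel z a -> rel z b -> a = b.
  move=> [m [n [E ->]]] [m' [n' [E' ->]]].
  apply/eqP; rewrite eqr_div ?expf_neq0 // -!exprD; apply/eqP/cy.
  by rewrite iterD -E' -iterD addnC iterD E -iterD.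
pose chi z := if pselect (exists a, rel z a) is left w then projT1 (cid w) else 0.
have chiP z a : rel z a -> chi z = a.
  rewrite /chi => ra; case: pselect => [w|[]]; last by exists a.
  by apply: rel_uniq ra; case: (cid w).
have chi0 z : ~ (exists a, rel z a) -> chi z = 0 by rewrite /chi; case: pselect.
exists chi; split=> [z||z].
- have [[a ra]|noz] := pselect (exists a, rel z a).
    case: (ra) => m [n [E Ea]]; rewrite (chiP _ _ ra).
    have r' : rel (f z) (c ^+ m / c ^+ n.+1).
      by exists m, n.+1; split; rewrite // -iterSr /= E.
    by rewrite (chiP _ _ r') Ea exprS invfM mulrCA mulVKf.
  rewrite chi0 // chi0 ?mulr0 // => -[_ [m [n [E _]]]]; apply: noz.
  by exists (c ^+ m.+1 / c ^+ n), m.+1, n; split; rewrite // iterSr.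
- by apply: chiP; exists 0%N, 0%N; rewrite divr1.
- have [[a [m [n [E _]]]] _|noz] := pselect (exists a, rel z a); first by exists m, n.
  by rewrite chi0 ?eqxx.
Qed.

(** [Y] is divisible by every power of [K], while a nonzero entry [y] is not divisible by
    [K ^ |y| > |y|]. *)
Lemma divisible_fixed_row d (Y : 'rV[int]_d) (N : 'M[int]_d) (K : int) :
  1 < K -> Y = K *: (Y *m N) -> Y = 0.
Proof.
move=> K1 E.
have iterE r : exists X : 'rV[int]_d, Y = K ^+ r *: X.
  elim: r => [|r [X EX]]; first by exists Y; rewrite scale1r.
  by exists (X *m N); rewrite {1}E {1}EX -scalemxAl scalerA -exprS.
apply/rowP => i; rewrite [RHS]mxE; apply/eqP; apply: contraT => Yi.
set y := Y 0 i in Yi; have [X EX] := iterE (absz y).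
have : (K ^+ absz y %| y)%Z.
  move/rowP: EX => /(_ i); rewrite mxE -/y => Ey.
  by rewrite [X in (_ %| X)%Z]Ey dvdz_mulr.
case: K K1 {E iterE EX} => // K K1.
rewrite dvdzE abszX absz_nat => /dvdn_leq; rewrite absz_gt0 => /(_ Yi).
by rewrite leqNgt ltn_expl.
Qed.

Lemma additive_mx m n (f : 'rV[int]_m -> 'rV[int]_n) :
  {morph f : x y / x + y} -> exists M, forall x, f x = x *m M.
Proof.
move=> fD; have f0 : f 0 = 0 by apply: (addrI (f 0)); rewrite -fD !addr0.
have fN x : f (- x) = - f x by apply/(addrI (f x)); rewrite -fD !subrr.
have fMn x k : f (x *+ k) = f x *+ k.
  by elim: k => [|k IH]; rewrite ?f0 // !mulrS fD IH.
have fZ a x : f (a *: x) = a *: f x.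
  by rewrite -[a]intz !scaler_int; case: a => k /=; rewrite ?fN fMn.
exists (\matrix_i f (delta_mx 0 i)) => x.
rewrite [x in LHS]row_sum_delta (big_morph f fD f0) mulmx_sum_row.
by apply: eq_bigr => i _; rewrite fZ rowK.
Qed.

(** * The wreath product as a group *)

Section WreathProduct.
Variables q d : nat.
Implicit Types (f g b : ZD d -> Lamp q) (v w x y : ZD d) (h k : WT q d).

(* [inW (f, v)] is convertible to [fin f]. *)
Definition fin f := exists s : seq (ZD d), forall x, x \notin s -> f x = 0.

Lemma fin0 : fin 0. Proof. by exists [::]. Qed.

Lemma finD f g : fin f -> fin g -> fin (f + g).
Proof.
move=> [s sf] [t tg]; exists (s ++ t) => x; rewrite mem_cat negb_or => /andP[xs xt].
by rewrite addrfctE sf // tg // addr0.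
Qed.

Lemma finN f : fin f -> fin (- f).
Proof. by move=> [s sf]; exists s => x xs; rewrite opprfctE sf // oppr0. Qed.

Lemma finB f g : fin f -> fin g -> fin (f - g).
Proof. by move=> ff fg; apply/finD/finN. Qed.

Lemma finMn f n : fin f -> fin (f *+ n).
Proof. by move=> ff; elim: n => [|n IH]; [exact: fin0|rewrite mulrS; apply: finD]. Qed.

Lemma fin_shift f v : fin f -> fin (fun x => f (x - v)).
Proof.
move=> [s sf]; exists [seq x + v | x <- s] => x xs; apply: sf.
by apply: contra xs => xs; apply/mapP; exists (x - v); rewrite ?subrK.
Qed.

Definition dl y : ZD d -> Lamp q := fun x => if x == y then inZp 1 else 0.

Lemma fin_dl y : fin (dl y).
Proof. by exists [:: y] => x; rewrite inE /dl => /negPf->. Qed.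

Lemma Lamp_mulrn (a : Lamp q) : inZp 1 *+ a = a :> Lamp q.
Proof. by rewrite Zp_mulrn; apply: val_inj; rewrite /= modnMml mul1n modn_small. Qed.

Lemma Lamp_mulrn_q (a : Lamp q) : (0 < q)%N -> a *+ q = 0.
Proof.
move=> q0; rewrite Zp_mulrn; apply: val_inj => /=.
by move: (a : nat) => n; rewrite prednK // modnMl.
Qed.

Lemma fin_ind (P : (ZD d -> Lamp q) -> Prop) :
    P 0 -> (forall y n f, fin f -> P f -> P (dl y *+ n + f)) ->
  forall f, fin f -> P f.
Proof.
move=> P0 PD f [s]; elim: s f => [|y s IH] f sf.
  by rewrite (_ : f = 0) //; apply/funext => x; apply: sf.
pose f' x := if x == y then 0 else f x.
have sf' x : x \notin s -> f' x = 0.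
  rewrite /f'; case: eqP => // /eqP xy xs.
  by apply: sf; rewrite inE negb_or xy.
have -> : f = dl y *+ (f y) + f'.
  apply/funext => x; rewrite addrfctE natmulfctE /dl /f'.
  by case: eqP => [->|_]; rewrite ?Lamp_mulrn ?addr0 // mul0rn add0r.
by apply: PD; [exists s | apply: IH].
Qed.

Lemma wmulA h k l : wmul h (wmul k l) = wmul (wmul h k) l :> WT q d.
Proof.
rewrite /wmul /= addrA; congr pair; apply/funext => x.
by rewrite addrA opprD (addrA x).
Qed.

Lemma wmul1g h : wmul (wone q d) h = h.
Proof.
case: h => f v; rewrite /wmul /= add0r; congr pair.
by apply/funext => x; rewrite add0r subr0.
Qed.

Lemma wmulg1 h : wmul h (wone q d) = h.
Proof.
by case: h => f v; rewrite /wmul /= addr0; congr pair; apply/funext => x; rewrite addr0.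
Qed.

Lemma wmulVg h : wmul (winv h) h = wone q d.
Proof.
case: h => f v; rewrite /wmul /= addNr; congr pair.
by apply/funext => x; rewrite opprK addNr.
Qed.

Lemma wmulgV h : wmul h (winv h) = wone q d.
Proof.
case: h => f v; rewrite /wmul /= subrr; congr pair.
by apply/funext => x; rewrite subrK subrr.
Qed.

Lemma wmulKg h k : wmul (winv h) (wmul h k) = k.
Proof. by rewrite wmulA wmulVg wmul1g. Qed.

Lemma wmulgI h k l : wmul h k = wmul h l -> k = l :> WT q d.
Proof. by move=> E; rewrite -[k](wmulKg h) E wmulKg. Qed.

Lemma winv_mul h k : winv (wmul h k) = wmul (winv k) (winv h) :> WT q d.
Proof.
apply: (@wmulgI (wmul h k)); rewrite wmulgV -wmulA (wmulA k) wmulgV wmul1g.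
by rewrite wmulgV.
Qed.

Lemma winvK h : winv (winv h) = h.
Proof. by apply: (@wmulgI (winv h)); rewrite wmulgV wmulVg. Qed.

Lemma inW1 : inW (wone q d). Proof. exact: fin0. Qed.

Lemma inWM h k : inW h -> inW k -> inW (wmul h k).
Proof. by move=> fh fk; apply: finD => //; apply: fin_shift. Qed.

Lemma inWV h : inW h -> inW (winv h).
Proof.
move=> /(@fin_shift _ (- h.2))/finN; congr fin; apply/funext => x.
by rewrite opprfctE opprK.
Qed.

Lemma wmul_lamp f g : wmul (f, 0) (g, 0) = (f + g, 0) :> WT q d.
Proof. by rewrite /wmul /= addr0; congr pair; apply/funext => x; rewrite subr0. Qed.

Lemma wmul_split f v : wmul (f, 0) (0, v) = (f, v) :> WT q d.
Proof. by rewrite /wmul /= add0r; congr pair; apply/funext => x; rewrite addr0. Qed.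

Lemma wmul_base v w : wmul (0, v) (0, w) = (0, v + w) :> WT q d.
Proof. by rewrite /wmul /=; congr pair; apply/funext => x; rewrite addr0. Qed.

Lemma wmul_lampC h f : wmul h (f, 0) = wmul (fun x => f (x - h.2), 0) h.
Proof.
case: h => b w; rewrite /wmul /= addr0 add0r; congr pair; apply/funext => x.
by rewrite subr0 addrC.
Qed.

Lemma winv_lamp f : winv (f, 0) = (- f, 0) :> WT q d.
Proof. by rewrite /winv /= oppr0; congr pair; apply/funext => x; rewrite addr0. Qed.

End WreathProduct.

Arguments dl {q d} y x.
Arguments fin_dl {q d} y.

(** * Twisted classes and the matrix induced on Z^d *)

Section Automorphism.
Variables (q d : nat) (phi : WT q d -> WT q d).
Hypotheses (q_gt0 : (0 < q)%N) (phi_aut : is_aut phi).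

Let phiW h : inW h -> inW (phi h). Proof. by case: phi_aut => H _ _ _; apply: H. Qed.
Let phiM h k : inW h -> inW k -> phi (wmul h k) = wmul (phi h) (phi k).
Proof. by case: phi_aut => _ H _ _; apply: H. Qed.

Lemma aut1 : phi (wone q d) = wone q d.
Proof.
apply: (@wmulgI _ _ (phi (wone q d))).
by rewrite -phiM ?wmul1g ?wmulg1 //; apply: inW1.
Qed.

Lemma autV h : inW h -> phi (winv h) = winv (phi h).
Proof.
move=> hW; apply: (@wmulgI _ _ (phi h)).
by rewrite -phiM ?wmulgV ?aut1 //; apply: inWV.
Qed.

Lemma twconj_common h k l : inW h -> inW k -> inW l ->
  twconj phi h l -> twconj phi k l -> twconj phi h k.
Proof.
move=> hW kW lW [a aW Eh] [b bW Ek]; exists (wmul a (winv b)).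
  by apply/inWM/inWV.
rewrite winv_mul winvK phiM //; last exact: inWV.
rewrite {1}Eh {1}Ek (autV bW).
by rewrite -!wmulA (wmulA (winv (phi b))) wmulVg wmul1g wmulKg.
Qed.

Lemma twconj_trans h k l : twconj phi h k -> twconj phi k l -> twconj phi h l.
Proof.
move=> [a aW ->] [b bW ->]; exists (wmul a b); first exact: inWM.
rewrite winv_mul phiM; [|exact: inWV|exact: inWV].
by rewrite !wmulA.
Qed.

Lemma twconj_pigeonhole N (gs : nat -> WT q d) : reidemeister_eq phi N ->
    (forall i, inW (gs i)) ->
  exists i j, (i < j)%N /\ twconj phi (gs i) (gs j).
Proof.
move=> [s [sN sW _ sall]] gW.
have /fin_all_exists[c cP] : forall i : 'I_N.+1, exists j : 'I_N,
    twconj phi (gs i) (nth (wone q d) s j).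
  by move=> i; have [j jN tj] := sall _ (gW i); exists (Ordinal jN).
have /injectivePn[i [j ij cij]] : ~~ injectiveb c.
  by apply/negP => /injectiveP/leq_card; rewrite !card_ord ltnn.
have conj a b : c a = c b -> twconj phi (gs a) (gs b).
  move=> cab; apply: twconj_common (cP a) _ => //; first exact: sW.
  by rewrite cab; apply: cP.
case: (ltngtP i j) => [lt_ij|lt_ji|/val_inj eij].
- by exists i, j; split=> //; apply: conj.
- by exists j, i; split=> //; apply: conj.
- by rewrite eij eqxx in ij.
Qed.

(** [f] is killed by [q], hence so is its image, whose base component then vanishes because Z^d is
    torsion-free. *)
Lemma aut_lamp f : fin f -> (phi (f, 0)).2 = 0.
Proof.
move=> ff; pose pow k n := iter n (wmul k) (wone q d).
have powW k n : inW k -> inW (pow k n).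
  by move=> kW; elim: n => [|n IH]; [apply: inW1 | apply: inWM].
have pow_phi k n : inW k -> phi (pow k n) = pow (phi k) n.
  by move=> kW; elim: n => [|n IH]; rewrite ?aut1 //= phiM ?IH //; apply: powW.
have pow_lamp n : pow (f, 0) n = (f *+ n, 0).
  by elim: n => [//|n IH]; rewrite /pow iterS -/(pow _ n) IH wmul_lamp mulrS.
have pow2 k n : (pow k n).2 = k.2 *+ n.
  by elim: n => [//|n IH]; rewrite /pow iterS -/(pow _ n) /= IH mulrS.
have fW : inW ((f, 0) : WT q d) by [].
have f_torsion : f *+ q = 0.
  by apply/funext => x; rewrite natmulfctE Lamp_mulrn_q.
have := pow2 (phi (f, 0)) q; rewrite -pow_phi // pow_lamp f_torsion.
rewrite (aut1 : phi (0, 0) = _) /= => /esym/rowP E; apply/rowP => i.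
by have := E i; rewrite mulmxnE !mxE => /eqP; rewrite mulrn_eq0 eqn0Ngt q_gt0 => /eqP.
Qed.

Lemma aut_base : exists M N : 'M[int]_d, [/\ M *m N = 1%:M, N *m M = 1%:M &
  forall g, inW g -> (phi g).2 = g.2 *m M].
Proof.
have baseW v : inW ((0, v) : WT q d) by apply: fin0.
have [M EM] : exists M, forall v, (phi (0, v)).2 = v *m M.
  apply: (@additive_mx d d (fun v => (phi (0, v)).2)) => v w.
  by rewrite -wmul_base phiM.
have phi2 g : inW g -> (phi g).2 = g.2 *m M.
  case: g => f v fW; rewrite -wmul_split phiM; [|exact: fW|exact: baseW].
  by rewrite /= aut_lamp // add0r EM add0r.
have /fin_all_exists[r rP] : forall i : 'I_d, exists w : 'rV[int]_d, w *m M = delta_mx 0 i.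
  move=> i; case: phi_aut => _ _ _ /(_ _ (baseW (delta_mx 0 i)))[g gW E].
  by exists g.2; rewrite -phi2 // E.
have NM : (\matrix_i r i) *m M = 1%:M.
  by apply/row_matrixP => i; rewrite row_mul rowK rP row1.
by exists M, (\matrix_i r i); split=> //; apply: mulmx1C.
Qed.

End Automorphism.

(** * Action of the automorphism on the lamp group *)

Section LampAction.
Variables (q d : nat) (phi : WT q d -> WT q d).
Hypotheses (q_gt0 : (0 < q)%N) (phi_aut : is_aut phi).
Variables M N : 'M[int]_d.
Hypotheses (MN : M *m N = 1%:M) (NM : N *m M = 1%:M).
Hypothesis phi2 : forall g, inW g -> (phi g).2 = g.2 *m M.
Implicit Types (f g b : ZD d -> Lamp q) (v w x y z : ZD d).

Let phiW h : inW h -> inW (phi h). Proof. by case: phi_aut => H _ _ _; apply: H. Qed.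
Let phiM h k : inW h -> inW k -> phi (wmul h k) = wmul (phi h) (phi k).
Proof. by case: phi_aut => _ H _ _; apply: H. Qed.

Definition act f := (phi (f, 0)).1.
(** This is T over [v]: when [(f, v)] is twisted by a lamp [b], the factor coming from [phi] must be
    moved past [v], which shifts it by [v]. *)
Definition tw v f : ZD d -> Lamp q := fun x => act f (x - v).

Lemma phi_lamp f : fin f -> phi (f, 0) = (act f, 0).
Proof. by move=> ff; rewrite [LHS]surjective_pairing phi2 //= mul0mx. Qed.

Lemma fin_act f : fin f -> fin (act f).
Proof. by move=> ff; apply: (phiW (h := (f, 0))). Qed.

Lemma actD f g : fin f -> fin g -> act (f + g) = act f + act g.
Proof.
move=> ff fg; have := phi_lamp (finD ff fg).
by rewrite -wmul_lamp phiM // !phi_lamp // wmul_lamp => -[].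
Qed.

Lemma act0 : act 0 = 0.
Proof. by rewrite /act (aut1 phi_aut : phi (0, 0) = _). Qed.

Lemma actN f : fin f -> act (- f) = - act f.
Proof.
move=> ff; apply: (addrI (act f)); rewrite -actD ?subrr ?act0 //; exact: finN.
Qed.

Lemma actMn f n : fin f -> act (f *+ n) = act f *+ n.
Proof.
move=> ff; elim: n => [|n IH]; first exact: act0.
by rewrite !mulrS actD ?IH //; apply: finMn.
Qed.

Lemma act_shift y f : fin f -> act (fun x => f (x - y)) = fun x => act f (x - y *m M).
Proof.
move=> ff; have baseW : inW ((0, y) : WT q d) by apply: fin0.
have fyW := fin_shift y ff.
have /(congr1 phi) := wmul_lampC (0, y) f; rewrite !phiM //.
rewrite !phi_lamp // [phi (0, y)]surjective_pairing phi2 //= => -[E _].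
apply/funext => x; have := congr1 (@^~ x) E.
by rewrite /= subr0 => E'; apply: (addIr ((phi (0, y)).1 x)); rewrite -E' addrC.
Qed.

Lemma act_surj g : fin g -> exists2 f, fin f & act f = g.
Proof.
move=> fg; case: phi_aut => _ _ _ /(_ (g, 0) fg)[[f v] fW E].
have := phi2 fW; rewrite E /= => vM.
have v0 : v = 0 by rewrite -[v]mulmx1 -MN mulmxA -vM mul0mx.
by exists f => //; rewrite /act -v0 E.
Qed.

Lemma fin_tw v f : fin f -> fin (tw v f).
Proof. by move=> ff; apply/fin_shift/fin_act. Qed.

Lemma twD v f g : fin f -> fin g -> tw v (f + g) = tw v f + tw v g.
Proof. by move=> ff fg; rewrite /tw actD. Qed.

Lemma tw0 v : tw v 0 = 0. Proof. by rewrite /tw act0. Qed.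

Lemma twMn v f n : fin f -> tw v (f *+ n) = tw v f *+ n.
Proof. by move=> ff; apply/funext => x; rewrite /tw actMn // !natmulfctE. Qed.

Lemma twconj_lamp v f b : fin b -> twconj phi (f + (b - tw v b), v) (f, v).
Proof.
move=> fb; exists (b, 0) => //.
rewrite winv_lamp phi_lamp; last exact: finN.
rewrite actN // /wmul /= add0r addr0; congr pair; apply/funext => x.
by rewrite !fctE subr0 /tw addrA [f x + _]addrC.
Qed.

Lemma twconj_lampP v f g : (forall w, w = w *m M -> w = 0) ->
  twconj phi (f, v) (g, v) -> exists2 b, fin b & f = g + (b - tw v b).
Proof.
move=> fixM [[b w] hW [Ef Ev]]; have hVW := inWV hW.
have w0 : w = 0.
  apply: fixM; apply: (addIr v); rewrite [in RHS]Ev phi2 //= mulNmx.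
  by rewrite addrCA subrr addr0.
exists b => //; move: Ef hVW; rewrite {}w0 winv_lamp phi_lamp; last exact: finN.
rewrite actN // => -> _; apply/funext => x.
by rewrite !fctE subr0 add0r /tw addrA [g x + _]addrC.
Qed.

(** * Reduction modulo a prime divisor of q *)

Section ModP.
Variable p : nat.
Hypotheses (p_pr : prime p) (pq : (p %| q)%N).

Definition red (a : Lamp q) : 'F_p := (a : nat)%:R.

Lemma natr_modq n : (n %% q.-1.+1)%:R = n%:R :> 'F_p.
Proof.
rewrite prednK //  [in RHS](divn_eq n q) natrD natrM.
have /eqP -> : (q%:R : 'F_p) == 0.
  by rewrite -(dvdn_pcharf (pchar_Fp p_pr)).
by rewrite mulr0 add0r.
Qed.

Lemma redD (a a' : Lamp q) : red (a + a') = red a + red a'.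
Proof. by rewrite /red /= natr_modq natrD. Qed.

Lemma red0 : red 0 = 0. Proof. by []. Qed.

Lemma redMn (a : Lamp q) n : red (a *+ n) = n%:R * red a.
Proof.
by elim: n => [|n IH]; rewrite ?mul0r // mulrS redD IH -[n.+1%:R]natr1 mulrDl mul1r addrC.
Qed.

Lemma redN (a : Lamp q) : red (- a) = - red a.
Proof. by apply: (addrI (red a)); rewrite -redD !subrr. Qed.

Lemma red_dl y x : red (dl y x) = (x == y)%:R.
Proof.
rewrite /dl; case: eqP => // _.
by rewrite /red /inZp /= natr_modq.
Qed.

Lemma red_eq0 (a : Lamp q) : red a = 0 -> exists e : Lamp q, a = e *+ p.
Proof.
move/eqP; rewrite -(dvdn_pcharf (pchar_Fp p_pr)) => /dvdnP[m Em].
by exists (inZp 1 *+ m); rewrite -mulrnA -Em Lamp_mulrn.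
Qed.

Lemma act_dl y : act (dl y) = fun x => act (dl 0) (x - y *m M).
Proof.
rewrite -act_shift; last exact: fin_dl.
by congr act; apply/funext => x; rewrite /dl subr_eq0.
Qed.

(** Modulo [p], [act] is convolution with [act (dl 0)] after moving the support by [M]. All lists
    containing [s0] are allowed so that the list can grow during the induction. *)
Lemma red_act f : fin f -> exists s0 : seq (ZD d), forall s, uniq s -> {subset s0 <= s} ->
  forall x, red (act f x) = \sum_(y <- s) red (f y) * red (act (dl 0) (x - y *m M)).
Proof.
elim/fin_ind => {f} [|y n f ff [s0 IH]].
  by exists [::] => s _ _ x; rewrite act0 big1 // => y _; rewrite red0 mul0r.
exists (y :: s0) => s us ss x.
have fdl := fin_dl y.
rewrite actD //; last exact: finMn.
rewrite actMn // !(natmulfctE, fctE) redD redMn act_dl (IH s) //; last first.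
  by move=> z zs; apply: ss; rewrite inE zs orbT.
under [RHS]eq_bigr => z _ do rewrite redD redMn mulrDl red_dl.
rewrite big_split /=; congr (_ + _).
rewrite (bigD1_seq y) ?ss ?mem_head //= eqxx mulr1 big1 ?addr0 // => z /negPf->.
by rewrite mulr0 mul0r.
Qed.

Lemma mulM_inj : injective (fun x : ZD d => x *m M).
Proof. by move=> x y /(congr1 (mulmx^~ N)); rewrite -!mulmxA MN !mulmx1. Qed.

(** A preimage of [dl 0] supplies a convolution inverse of [act (dl 0)] modulo [p], so the latter is
    a unit of the group ring, hence a monomial. *)
Lemma act_dl_monomial : exists v0 (c : 'F_p), c != 0 /\
  forall x, red (act (dl 0) x) = if x == v0 then c else 0.
Proof.
have [h fh Eh] := act_surj (fin_dl 0).
have [s0 /(_ (undup s0) (undup_uniq _))Es] := red_act fh.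
have [su Esu] := fin_act (fin_dl 0).
have [||v0 c0 v0P] := @convolution_unit_monomial 'F_p d (red \o act (dl 0)) (red \o h)
    (fun x => x *m M) su (undup s0) mulM_inj (undup_uniq _).
- by move=> x /Esu /= ->.
- move=> x /=; rewrite -Es; last by move=> y; rewrite mem_undup.
  by rewrite Eh red_dl.
exists v0, (red (act (dl 0) v0)); split=> // x.
by case: eqP => [->|/eqP/v0P].
Qed.

(** * Orbits of the affine map and invariant characters *)

Section Orbits.
Variables (v0 v : ZD d) (c : 'F_p).
Hypotheses (c0 : c != 0)
  (mono : forall x, red (act (dl 0) x) = if x == v0 then c else 0).
(** The map alpha: modulo [p], [tw v] sends the point mass at [y] to [c] times the point mass at
    [af y]. *)
Definition af y : ZD d := y *m M + (v0 + v).

Lemma red_tw_af f z : fin f -> red (tw v f (af z)) = c * red (f z).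
Proof.
rewrite /tw /af [v0 + v in X in red X]addrC addrA addrAC addrK.
elim/fin_ind => {f} [|y n f ff IH]; first by rewrite act0 red0 mulr0.
have fdl := @fin_dl q d y.
rewrite actD //; last exact: finMn.
rewrite actMn // !(natmulfctE, fctE) !redD !redMn IH mulrDr act_dl mono red_dl.
rewrite -[_ == v0]subr_eq0 addrAC addrK subr_eq0 (inj_eq mulM_inj).
by congr (_ + _); case: eqP => _; rewrite ?mulr0 ?mulr1 1?mulrC.
Qed.

Lemma af_surj x : exists y, x = af y.
Proof. by exists ((x - (v0 + v)) *m N); rewrite /af -mulmxA NM mulmx1 subrK. Qed.

Lemma af_inj : injective af.
Proof. by move=> x y /addIr/mulM_inj. Qed.

(** Pairing with [chi] modulo [p] is unchanged by [tw v], so it kills [b - tw v b]. *)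
Lemma character_invariant (chi : ZD d -> 'F_p) y1 y2 b :
    (forall z, chi z = c * chi (af z)) -> fin b -> dl y1 = dl y2 + (b - tw v b) ->
  chi y1 = chi y2.
Proof.
move=> chiP fb E; have [s0 s0b] := fb.
pose s := undup s0; pose t := undup (y1 :: y2 :: s ++ [seq af z | z <- s]).
have us : uniq s by apply: undup_uniq.
have sb x : x \notin s -> b x = 0 by rewrite mem_undup; apply: s0b.
have sum_dl y : y \in t -> \sum_(x <- t) chi x * red (dl y x) = chi y.
  move=> yt; rewrite (bigD1_seq y) ?undup_uniq //= red_dl eqxx mulr1 big1 ?addr0 // => x.
  by rewrite red_dl => /negPf->; rewrite mulr0.
have sum_b : \sum_(x <- t) chi x * red (b x) = \sum_(x <- s) chi x * red (b x).
  apply: sum_seq_sub => // [|x xs|x /sb->]; first exact: undup_uniq.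
    by rewrite mem_undup !inE mem_cat xs !orbT.
  by rewrite red0 mulr0.
have sum_tb : \sum_(x <- t) chi x * red (tw v b x) = \sum_(x <- s) chi x * red (b x).
  rewrite (@sum_seq_sub _ _ [seq af z | z <- s] t).
  - rewrite big_map; apply: eq_bigr => z _.
    by rewrite red_tw_af // mulrCA mulrA -chiP.
  - by rewrite map_inj_uniq //; apply: af_inj.
  - exact: undup_uniq.
  - by move=> x xs; rewrite mem_undup !inE mem_cat xs !orbT.
  - move=> x; have [z ->] := af_surj x.
    by rewrite (mem_map af_inj) => /sb bz; rewrite red_tw_af // bz red0 !mulr0.
have y1t : y1 \in t by rewrite mem_undup mem_head.
have y2t : y2 \in t by rewrite mem_undup !inE eqxx orbT.
rewrite -(sum_dl y1) // -(sum_dl y2) //.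
rewrite {}E; under eq_bigr => x _ do rewrite !fctE !redD redN mulrDr mulrBr.
by rewrite big_split sumrB /= sum_b sum_tb subrr addr0.
Qed.

(** The condition under which the orbit carries a nonzero [tw v]-invariant character; it can fail
    only on a finite orbit. *)
Definition uniform_orbit y :=
  forall m n, iter m af y = iter n af y -> c ^+ m = c ^+ n.

Variable K : nat.
Hypotheses (hR : reidemeister_eq phi K) (d_gt0 : (0 < d)%N).
Let D := \det (1%:M - M).
Hypothesis D0 : D != 0.

(* The fixed point of [af] over Q is [zeta / D]. *)
Let zeta : ZD d := (v0 + v) *m \adj (1%:M - M).
Let gam y : ZD d := D *: y - zeta.
(** The ratio of a dilation about the fixed point [zeta / D]. Since [K1 - 1] is a multiple of [D],
    the dilation preserves Z^d; the square gives [K1 > 1] whatever the sign of [D]. *)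
Let K1 : int := 1 + D ^+ 2.
Let dilate y : ZD d := K1 *: y - D *: zeta.

Let gam_inj : injective gam.
Proof. by move=> x y /addIr/(scalemx_inj D0). Qed.

Let gam_af y : gam (af y) = gam y *m M.
Proof.
have : zeta *m (1%:M - M) = D *: (v0 + v).
  by rewrite -mulmxA mul_adj_mx mul_mx_scalar.
rewrite mulmxBr mulmx1 => zetaE.
rewrite /gam /af scalerDr -zetaE mulmxBl -scalemxAl -addrA; congr (_ + _).
by rewrite addrAC subrr add0r.
Qed.

Let gam_dilate y : gam (dilate y) = K1 *: gam y.
Proof.
rewrite /gam /dilate !scalerBr !scalerA [D * K1]mulrC -addrA; congr (_ + _).
by rewrite /K1 scalerDl scale1r opprD expr2 addrC.
Qed.

Let iter_gam_af m y : gam (iter m af y) = gam y *m iter m (mulmx^~ M) 1%:M.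
Proof. by elim: m => [|m IH] /=; rewrite ?mulmx1 // gam_af IH mulmxA. Qed.

(** Both maps fix the point [zeta / D], so the dilation commutes with the affine map and carries
    uniform orbits to uniform orbits. *)
Let dilate_af m y : iter m af (dilate y) = dilate (iter m af y).
Proof.
apply: gam_inj; rewrite iter_gam_af !gam_dilate iter_gam_af.
by rewrite scalemxAl.
Qed.

Let K1_gt1 : 1 < K1.
Proof. by rewrite ltrDl exprn_even_gt0 //= orbF. Qed.

Let dilate_inj : injective dilate.
Proof.
move=> x y /(congr1 gam); rewrite !gam_dilate => E; apply: gam_inj.
by apply: (scalemx_inj _ E); rewrite gt_eqF // (lt_trans _ K1_gt1).
Qed.

Let uniform_dilate i y : uniform_orbit y -> uniform_orbit (iter i dilate y).
Proof.
move=> uy; elim: i => //= i IH m n.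
by rewrite !dilate_af => /dilate_inj/IH.
Qed.

Let gam_iter_dilate i y : gam (iter i dilate y) = K1 ^+ i *: gam y.
Proof.
by elim: i => [|i IH] /=; rewrite ?scale1r // gam_dilate IH scalerA exprS.
Qed.

Let iterM_unit m : exists N', iter m (mulmx^~ M) 1%:M *m N' = 1%:M.
Proof.
elim: m => [|m [N' EN]] /=; first by exists 1%:M; rewrite mulmx1.
by exists (N *m N'); rewrite -mulmxA (mulmxA M) MN mul1mx.
Qed.

(* The dilates of the orbit give infinitely many orbits carrying invariant
   characters, hence infinitely many twisted classes over [v]. *)
Lemma not_uniform_off_center y : gam y != 0 -> ~ uniform_orbit y.
Proof.
move=> gy uy; pose ys i := iter i dilate y.
have fixM (w : ZD d) : w = w *m M -> w = 0.
  move=> wM; apply: (scalemx_inj D0); rewrite scaler0.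
  by rewrite -mul_mx_scalar -mul_mx_adj mulmxA mulmxBr mulmx1 -wM subrr mul0mx.
have [|i [j [lt_ij]]] := twconj_pigeonhole phi_aut (gs := fun i => (dl (ys i), v)) hR.
  by move=> i; apply: (fin_dl (ys i)).
case/(twconj_lampP fixM) => b fb E.
have [chi [chiP chi1 chi_supp]] := orbit_character c0 (@uniform_dilate i y uy).
(* Invariance gives [chi (ys j) = chi (ys i) = 1], so the orbits of [ys j] and [ys i] meet. Read
   through [gam], this makes [gam y] equal to [K1 ^ (j - i)] times its image under an integral
   matrix, which only 0 can satisfy. *)
have : chi (ys j) != 0 by rewrite -(character_invariant chiP fb E) chi1 oner_eq0.
case/chi_supp => m [n] /(congr1 gam); rewrite !iter_gam_af !gam_iter_dilate.
set A := iter m _ _; set B := iter n _ _ => E'.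
have [N' BN'] := iterM_unit n; have [uB _] : B \in unitmx /\ N' \in unitmx := mulmx1_unit BN'.
apply/negP: gy; rewrite negbK; apply/eqP.
apply: (@divisible_fixed_row _ _ (A *m invmx B) (K1 ^+ (j - i))).
  by rewrite exprn_egt1 // -lt0n subn_gt0.
have K1i0 : K1 ^+ i != 0 by rewrite expf_neq0 // gt_eqF // (lt_trans _ K1_gt1).
apply: (scalemx_inj K1i0); rewrite scalerA -exprD subnKC ?(ltnW lt_ij) //.
by rewrite mulmxA !scalemxAl E' mulmxK.
Qed.

Lemma not_uniform y : ~ uniform_orbit y.
Proof.
have [gy|] := eqVneq (gam y) 0; last exact: not_uniform_off_center.
move=> uy; have fy : af y = y by apply: gam_inj; rewrite gam_af gy mul0mx.
(* [c = 1] makes every orbit uniform, in particular one off the center. *)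
have c1 : c = 1 by apply: (uy 1%N 0%N); rewrite /= fy.
pose e : ZD d := delta_mx 0 (Ordinal d_gt0).
have e0 : e != 0.
  by apply/eqP => /rowP/(_ (Ordinal d_gt0)); rewrite !mxE !eqxx.
apply: (@not_uniform_off_center (y + e)); last by move=> m n _; rewrite c1 !expr1n.
rewrite -gy (inj_eq gam_inj) -subr_eq0 addrAC subrr add0r //.
Qed.

Lemma lamp_modp : forall f, fin f -> exists b e,
  [/\ fin b, fin e & f = b - tw v b + e *+ p].
Proof.
(* [L] will be shown closed under sums and multiples, and dependent on values modulo [p] only; it
   then suffices to treat point masses. *)
pose L f := fin f /\ exists b e, [/\ fin b, fin e & f = b - tw v b + e *+ p].
have red_fin g : fin g -> (forall x, red (g x) = 0) -> exists2 e, fin e & g = e *+ p.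
  move=> [s sg] g0; have /choice[e eP] := fun x => red_eq0 (g0 x).
  exists (fun x => if x \in s then e x else 0).
    by exists s => x /negPf->.
  apply/funext => x; rewrite natmulfctE; case: ifPn => // xs.
  by rewrite mul0rn sg.
have L_red f g : L f -> fin g -> (forall x, red (f x) = red (g x)) -> L g.
  move=> [ff [b [e [fb fe Ef]]]] fg fgE; split=> //.
  have [|x|e' fe' Eg] := red_fin (g - f); first exact: finB.
    by rewrite !fctE redD redN fgE subrr.
  exists b, (e + e'); split=> //; first exact: finD.
  by rewrite mulrnDl addrA -Ef -Eg addrC subrK.
have LD f g : L f -> L g -> L (f + g).
  move=> [ff [b [e [fb fe Ef]]]] [fg [b' [e' [fb' fe' Eg]]]].
  split; first exact: finD.
  exists (b + b'), (e + e'); split; [exact: finD|exact: finD|].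
  by rewrite Ef Eg twD // mulrnDl opprD addrACA; congr (_ + _); rewrite addrACA.
have LMn f n : L f -> L (f *+ n).
  move=> Lf; elim: n => [|n IH]; last by rewrite mulrS; apply: LD.
  split; first exact: fin0.
  by exists 0, 0; split; rewrite ?tw0 ?subr0 ?mul0rn ?addr0 //; apply: fin0.
have Ltw f : fin f -> L (f - tw v f).
  move=> ff; split; first by apply: finB => //; apply: fin_tw.
  by exists f, 0; split; rewrite ?mul0rn ?addr0 //; apply: fin0.
have red_tw_dl y x : red (tw v (dl y) x) = c * (x == af y)%:R.
  have [z ->] := af_surj x.
  by rewrite red_tw_af ?red_dl ?(inj_eq af_inj) //; apply: fin_dl.
have LB f g h k : L f -> fin h ->
    (forall x, red (h x) = k%:R * red (f x) + red (g x)) -> L g -> L h.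
  move=> Lf fh E Lg; apply: (L_red (f *+ k + g)) => // [|x]; first by apply: LD => //; apply: LMn.
  by rewrite !(natmulfctE, fctE) redD redMn E.
pose cn : nat := c.
have cnE : cn%:R = c by rewrite natr_Zp.
(* Telescoping along the orbit: with [z = iter m af y], step [m] adds [c ^ m] times
   [dl z - tw v (dl z)], and modulo [p] the last term is [c] times the next point mass. *)
have L_step m y : L (dl y + - (dl (iter m af y) *+ (cn ^ m))).
  elim: m => [|m IH].
    by rewrite expn0 mulr1n subrr; apply: (LMn _ 0%N); apply: (Ltw 0 (fin0 _ _)).
  have fd k : fin (dl (iter k af y) *+ (cn ^ k)) by apply: finMn; apply: fin_dl.
  apply: (LB (dl (iter m af y) - tw v (dl (iter m af y))) _ _ (cn ^ m)%N _ _ _ IH) => [||x].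
  - by apply: Ltw; apply: fin_dl.
  - by apply: finB => //; apply: fin_dl.
  rewrite !(natmulfctE, fctE) !redD !redN !redMn red_tw_dl !red_dl !natrX cnE iterS.
  by rewrite /= exprS; ring.
have L_dl y : L (dl y).
  have /existsNP[m /existsNP[n /not_implyP[Emn cmn]]] := @not_uniform y.
  set w := iter m af y; have fdl x := @fin_dl q d x.
  (* Two visits to [w] with different powers of [c] put [c ^ n - c ^ m] times [dl w] into [L] modulo
     [p], with [p.-1] serving as -1; [t] inverts that factor. *)
  pose t : 'F_p := (c ^+ n - c ^+ m)^-1.
  have tE : (c ^+ n - c ^+ m) * t = 1.
    by rewrite mulfV // subr_eq0 eq_sym; apply/eqP.
  have Lw : L (dl w).
    pose h : ZD d -> Lamp q :=
      dl y - (dl w *+ (cn ^ m)) + (dl y - (dl w *+ (cn ^ n))) *+ (p.-1).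
    apply: (@L_red (h *+ (t : nat))) => // [|x].
      by apply/LMn/LD; [apply: L_step | apply: LMn; rewrite /w Emn; apply: L_step].
    rewrite /h !(natmulfctE, fctE) redMn redD redMn !redD !redN !redMn natr_Zp !natrX cnE.
    have -> : p.-1%:R = -1 :> 'F_p.
      by apply/eqP; rewrite -subr_eq0 opprK natr1 prednK ?prime_gt0 // pchar_Fp_0.
    by rewrite -[RHS]mul1r -[in RHS]tE; ring.
  apply: (LB (dl w) _ _ (cn ^ m)%N Lw (fdl y) _ (L_step m y)) => x.
  by rewrite !(natmulfctE, fctE) redD redN redMn addrC subrK.
move=> f ff; suff [] : L f by [].
elim/fin_ind: f / ff => [|y n g _ Lg].
  exact: (LMn _ 0%N (L_dl 0)).
by apply: LD => //; apply: LMn.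
Qed.

End Orbits.

End ModP.

Lemma twconj_base (g1 g2 : WT q d) : inW g1 -> inW g2 -> twconj phi g1 g2 ->
  exists w, g1.2 = g2.2 + w *m (1%:M - M).
Proof.
move=> W1 W2 [h hW ->]; exists h.2; rewrite /= phi2; last exact: inWV.
by rewrite /= mulmxBr mulmx1 mulNmx addrA [h.2 + _]addrC.
Qed.

(** * Twisted classes when R(phi) is finite *)

Section FiniteReidemeister.
Variable K : nat.
Hypotheses (hR : reidemeister_eq phi K) (d_gt0 : (0 < d)%N).

(** Otherwise some nonzero integer functional kills the image of [1%:M - M]. It is constant on
    twisted classes, yet takes infinitely many values on the multiples of a suitable unit vector. *)
Lemma det_base_neq0 : \det (1%:M - M) != 0.
Proof.
apply/negP; rewrite -det_tr => /det0P[u u0 uM].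
have {}uM : (1%:M - M) *m u^T = 0 by rewrite -[LHS]trmxK trmx_mul trmxK uM trmx0.
have /existsNP[i ui] : ~ forall i, u 0 i = 0.
  by move=> ui; case/eqP: u0; apply/rowP => i; rewrite ui mxE.
pose gs (j : nat) : WT q d := (0, j%:Z *: delta_mx 0 i).
have gsW j : inW (gs j) by apply: fin0.
have [j [k [lt_jk /twconj_base[]//]]] := twconj_pigeonhole phi_aut hR gsW.
move=> w /= /(congr1 (fun x => (x *m u^T) 0 0)).
rewrite mulmxDl -mulmxA uM mulmx0 addr0 -!scalemxAl -rowE !mxE.
move=> /(mulIf (introN eqP ui)) [] ejk.
by rewrite ejk ltnn in lt_jk.
Qed.

(** The primes of [q] are stripped one at a time: applying the statement modulo [p] to [e] in the
    remainder [e *+ (m %/ p)] turns it into a multiple of [m], and at [m = q] the remainder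
    vanishes. *)
Lemma lamp_surj v f : fin f -> exists2 b, fin b & f = b - tw v b.
Proof.
have step m : (0 < m)%N -> (m %| q)%N -> forall f, fin f ->
    exists b e, [/\ fin b, fin e & f = b - tw v b + e *+ m].
  elim/ltn_ind: m => m IH m0 mq {}f ff.
  have [m_le1|m_gt1] := leqP m 1.
    have -> : m = 1%N by apply/eqP; rewrite eqn_leq m_le1.
    by exists 0, f; split; rewrite ?tw0 ?subr0 ?add0r //; apply: fin0.
  have p_pr := pdiv_prime m_gt1; set p := pdiv m in p_pr.
  have pm : (p %| m)%N by apply: pdiv_dvd.
  have pq : (p %| q)%N := dvdn_trans pm mq.
  have [v0 [c [c0 mono]]] := act_dl_monomial p_pr pq.
  have [|||b [e [fb fe ->]]] := IH (m %/ p)%N _ _ _ f ff.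
  - by rewrite ltn_Pdiv // prime_gt1.
  - by rewrite divn_gt0 ?prime_gt0 // dvdn_leq.
  - by apply: dvdn_trans mq; apply: dvdn_div.
  have [b' [e' [fb' fe' ->]]] := lamp_modp p_pr pq v c0 mono hR d_gt0 det_base_neq0 fe.
  exists (b + b' *+ (m %/ p)), e'; split=> //; first by apply/finD/finMn.
  rewrite twD ?twMn //; last exact: finMn.
  rewrite mulrnDl mulrnBl -mulrnA [(p * _)%N]mulnC divnK // addrA opprD.
  by congr (_ + _); rewrite addrACA.
move=> ff; have [b [e [fb _ ->]]] := step q q_gt0 (dvdnn q) f ff.
exists b => //; rewrite (_ : e *+ q = 0) ?addr0 //.
by apply/funext => x; rewrite natmulfctE Lamp_mulrn_q.
Qed.

Lemma twconjE (g1 g2 : WT q d) : inW g1 -> inW g2 ->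
  twconj phi g1 g2 <-> exists w, g1.2 = g2.2 + w *m (1%:M - M).
Proof.
move=> W1 W2; split=> [|[w Ew]]; first exact: twconj_base.
have wW : inW ((0, w) : WT q d) by apply: fin0.
(* Twisting [g2] by [(0, w)] reaches the base component of [g1]; the remaining lamp difference is
   absorbed by [lamp_surj]. *)
pose g3 := wmul (wmul (0, w) g2) (phi (winv (0, w))).
have W3 : inW g3 by apply/inWM/phiW/inWV => //; apply: inWM.
have g3v : g3.2 = g1.2.
  rewrite Ew /g3 /= phi2; last exact: inWV.
  by rewrite /= mulmxBr mulmx1 mulNmx addrA [w + _]addrC.
have [|b fb Eb] := @lamp_surj g1.2 (g1.1 - g3.1); first exact: finB.
have t13 : twconj phi g1 g3.
  have := twconj_lamp g1.2 g3.1 fb.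
  by rewrite -Eb [g3.1 + _]addrC subrK -{2}g3v -!surjective_pairing.
by apply: (twconj_trans phi_aut t13); exists (0, w).
Qed.

End FiniteReidemeister.
End LampAction.

(** Write [P = L *m diag *m R] with [L] and [R] unimodular. The factor [L] only reparametrizes [w],
    and in the coordinates given by the inverse [S] of [R] the image is cut out by divisibility by
    the diagonal entries. *)
Lemma smith_image d (P : 'M[int]_d) : \det P != 0 ->
  exists (m : 'I_d -> nat) (R S : 'M[int]_d), [/\ R *m S = 1%:M, S *m R = 1%:M,
    forall i, (0 < m i)%N &
    forall y : 'rV_d, (exists w, y = w *m P) <-> forall i, (m i %| (y *m S) 0%R i)%Z].
Proof.
move=> P0; have [L uL [R uR [s _ EP]]] := int_Smith_normal_form P.
have {}EP : P = L *m diag_mx (\row_i s`_i) *m R.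
  rewrite EP; congr (_ *m _ *m _); apply/matrixP => i j.
  by rewrite !mxE; congr (_ *+ _); rewrite (inj_eq val_inj).
have s0 (i : 'I_d) : s`_i != 0.
  apply: contraNneq P0 => si0; rewrite EP !det_mulmx det_diag (bigD1 i) //= mxE si0.
  by rewrite mul0r mulr0 mul0r.
exists (fun i => absz s`_i), R, (invmx R); split=> [||i|y].
- exact: mulmxV.
- exact: mulVmx.
- by rewrite absz_gt0.
split=> [[w ->] i|dvd_y].
  rewrite EP !mulmxA mulmxK // mul_mx_diag !mxE.
  by rewrite dvdzE absz_nat -dvdzE dvdz_mull.
pose z i := (y *m invmx R) 0 i.
exists (\row_i (z i %/ s`_i)%Z *m invmx L).
rewrite EP -!mulmxA mulKmx // -[y in LHS](mulmxKV uR) mulmxA; congr (_ *m _).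
apply/rowP => i; rewrite mul_mx_diag [RHS]mxE [X in _ = X * _]mxE [X in _ = _ * X]mxE.
by rewrite divzK // dvdzE; have := dvd_y i; rewrite dvdzE.
Qed.

(** * Irreducible unitary representations *)

Lemma dotmx_eq0 (F : numClosedFieldType) n (y : 'rV[F]_n) :
  y *m (map_mx Num.conj y)^T = 0 -> y = 0.
Proof.
move/(congr1 (fun A : 'M_1 => A 0 0)); rewrite !mxE => /eqP.
rewrite psumr_eq0 => [|i _]; last by rewrite !mxE mul_conjC_ge0.
move/allP => y0; apply/rowP => i; rewrite mxE; apply/eqP.
by have := y0 i (mem_index_enum i); rewrite !mxE mul_conjC_eq0.
Qed.

Section Irreducible.
Variables (q d n : nat) (r : WT q d -> 'M[C]_n).
Hypothesis r_irr : irr_unitary_rep (FRep r).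
Implicit Types (g h : WT q d) (x y : 'rV[C]_n).

Let rM g h : inW g -> inW h -> r (wmul g h) = r g *m r h.
Proof. by case: r_irr => _ H _ _; apply: H. Qed.
Let rU g : inW g -> unitary_mx (r g).
Proof. by case: r_irr => _ _ H _; apply: H. Qed.
Let n_gt0 : (0 < n)%N. Proof. by case: r_irr. Qed.

Lemma rep1 : r (wone q d) = 1%:M.
Proof.
have W1 := @inW1 q d; have [u1 _] := mulmx1_unit (rU W1).
by rewrite -(mulKmx u1 (r (wone q d))) -rM // wmul1g mulVmx.
Qed.

Lemma irr_full (S : 'rV[C]_n -> Prop) v :
    S 0 -> (forall a x y, S x -> S y -> S (a *: x + y)) ->
    (forall g x, inW g -> S x -> S (x *m r g)) -> S v -> v != 0 ->
  forall x, S x.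
Proof.
move=> S0 Slin Sinv Sv v0 x; have [U US] := subspace_mx S0 Slin.
have /orP[/eqP U0|fU] : (U == 0) || row_full U.
- case: r_irr => _ _ _; apply=> g gW; apply/row_subP => i.
  by apply/US; rewrite row_mul; apply: Sinv => //; apply/US/row_sub.
- by case/eqP: v0; apply/eqP; rewrite -submx0 -U0; apply/US.
- by apply/US/submx_full.
Qed.

(** By unitarity, a nonzero inner product of [x] and [y] would give [a conj(b) = 1], while the norm
    of [y] gives [b conj(b) = 1]; hence [a = b]. *)
Lemma eigenrow_orthogonal g x y (a b : C) : inW g ->
    x *m r g = a *: x -> y *m r g = b *: y -> a != b ->
  x *m (map_mx Num.conj y)^T = 0.
Proof.
move=> gW xg yg ab.
have dotE (u w : 'rV[C]_n) : (u *m r g) *m (map_mx Num.conj (w *m r g))^T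
    = u *m (map_mx Num.conj w)^T.
  by rewrite map_mxM trmx_mul mulmxA -(mulmxA u) (rU gW) mulmx1.
apply/eqP; apply: contraNT ab => xy.
have y0 : y *m (map_mx Num.conj y)^T != 0.
  by apply: contraNneq xy => /dotmx_eq0->; rewrite map_mx0 trmx0 mulmx0.
have := dotE y y; have := dotE x y; rewrite xg yg map_mxZ linearZ /=.
rewrite -!scalemxAr -!scalemxAl !scalerA => Exy Eyy.
have scale1 (c : C) (A : 'M[C]_1) : A != 0 -> c *: A = A -> c = 1.
  move=> A0 E; apply/eqP; rewrite -subr_eq0.
  have /eqP : (c - 1) *: A = 0 by rewrite scalerBl E scale1r subrr.
  by rewrite scaler_eq0 (negPf A0) orbF.
have Eab := scale1 _ _ xy Exy; have Ebb := scale1 _ _ y0 Eyy.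
have b0 : b^* != 0 by apply: contra_eqN Ebb => /eqP->; rewrite ?mul0r ?mulr0 eq_sym oner_eq0.
apply/eqP; apply: (mulfI b0); by rewrite Eab Ebb.
Qed.

End Irreducible.

(** * Representations fixed by the automorphism *)

Section FixedRep.
Variables (q d n : nat) (phi : WT q d -> WT q d) (M : 'M[int]_d).
Hypotheses (phi_aut : is_aut phi)
  (phi2 : forall g, inW g -> (phi g).2 = g.2 *m M)
  (surj : forall v f, fin f -> exists2 b, fin b & f = b - tw phi v b).
Variables (r : WT q d -> 'M[C]_n) (P : 'M[C]_n).
Hypotheses (r_irr : irr_unitary_rep (FRep r)) (uP : P \in unitmx)
  (rP : forall g, inW g -> P *m r (phi g) = r g *m P).
Implicit Types (f g b : ZD d -> Lamp q) (v w : ZD d) (x y : 'rV[C]_n).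

Let rM h k : inW h -> inW k -> r (wmul h k) = r h *m r k.
Proof. by case: r_irr => _ H _ _; apply: H. Qed.
Let n_gt0 : (0 < n)%N. Proof. by case: r_irr. Qed.
Let r_unit h : inW h -> r h \in unitmx.
Proof. by case: r_irr => _ _ H _ /H/mulmx1_unit[]. Qed.
Let phiW h : inW h -> inW (phi h). Proof. by case: phi_aut => H _ _ _; apply: H. Qed.
Let phiL f : fin f -> phi (f, 0) = (act phi f, 0) := @phi_lamp _ _ _ _ phi2 f.
Let baseW w : inW ((0, w) : WT q d) := @fin0 q d.

Lemma fixed_rep_lamp_trivial f : fin f -> r (f, 0) = 1%:M.
Proof.
have [|u u0 uA] := @family_common_eigenvector _ _
  (fun A => exists2 f, fin f & A = r (f, 0)) n_gt0.
  move=> _ _ [f1 ff1 ->] [f2 ff2 ->].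
  by rewrite /comm_mx -!rM // !wmul_lamp addrC.
have /choice[psi psiP] : forall f, exists a, fin f -> u *m r (f, 0) = a *: u.
  move=> g; have [fg|nfg] := pselect (fin g); last by exists 0.
  by have [|a ua] := uA (r (g, 0)); [exists g | exists a].
have scale_inj (a b : C) : a *: u = b *: u -> a = b.
  move=> E; apply/eqP; rewrite -subr_eq0 -[_ == 0]orbF -(negPf u0) -scaler_eq0.
  by rewrite scalerBl E subrr.
have psiD g b : fin g -> fin b -> psi (g + b) = psi g * psi b.
  move=> fg fb; apply: scale_inj; rewrite -psiP; last exact: finD.
  by rewrite -wmul_lamp rM // mulmxA psiP // -scalemxAl psiP // scalerA.
(* The vector [u *m P] is an eigenvector of [r (act phi g, 0)] for [psi g]. If no [w] worked, it
   would be orthogonal to every [u *m r h], whose character is [psi] shifted by [h.2]. These vectors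
   span by irreducibility, so it would be orthogonal to itself. *)
have [w psi_tw] : exists w, forall g, fin g -> psi g = psi (tw phi w g).
  pose y := u *m P; pose yc := (map_mx Num.conj y)^T.
  have y0 : y != 0.
    by apply: contraNneq u0 => yE; rewrite -(mulmxK uP u) -/y yE mul0mx.
  have yE g : fin g -> y *m r (act phi g, 0) = psi g *: y.
    by move=> fg; rewrite -phiL // -mulmxA rP // mulmxA psiP // scalemxAl.
  apply: contrapT => /forallNP no_w; case/eqP: y0; apply: dotmx_eq0.
  suff H x : forall h, inW h -> x *m r h *m yc = 0.
    by have := H y (wone q d) (@inW1 q d); rewrite rep1 // mulmx1.
  apply: (irr_full r_irr (S := fun x => forall h, inW h -> x *m r h *m yc = 0) _ _ _ _ u0).
  - by move=> h _; rewrite !mul0mx.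
  - by move=> a x1 x2 H1 H2 h hW; rewrite !mulmxDl -!scalemxAl H1 // H2 // scaler0 addr0.
  - move=> h x1 hW H1 k kW; rewrite -(mulmxA x1) -rM //; apply: H1; exact: inWM.
  move=> h hW; have /existsNP[g /not_implyP[fg psi_neq]] := no_w h.2.
  have fa := fin_act phi_aut fg.
  apply: (eigenrow_orthogonal r_irr (g := (act phi g, 0)) fa _ (yE g fg)
            (a := psi (tw phi h.2 g))); last by apply/eqP => E; apply: psi_neq.
  have ft := fin_shift h.2 fa.
  by rewrite -mulmxA -rM // wmul_lampC rM // mulmxA psiP // scalemxAl.
(* Writing [g = b - tw phi w b], invariance of [psi] gives [psi g * psi b = psi b]. *)
have psi1 g : fin g -> psi g = 1.
  move=> fg; have [b fb Eg] := surj w fg.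
  have ft : fin (tw phi w b) by apply/fin_shift/fin_act.
  have : psi g * psi b = psi b.
    by rewrite {1}(psi_tw b) // -psiD // Eg subrK.
  have b0 : psi b != 0.
    apply: contraNneq u0 => pb0; have ub : r (b, 0) \in unitmx by apply: r_unit.
    by rewrite -(mulmxK ub u) psiP // pb0 scale0r mul0mx.
  by move=> E; apply: (mulIf b0); rewrite mul1r.
move=> ff; apply/row_matrixP => i; rewrite -[r _]mul1mx row_mul.
move: (row i 1%:M) => x.
apply: (irr_full r_irr (S := fun x => forall g, fin g -> x *m r (g, 0) = x) _ _ _ _ u0 _) => //.
- by move=> g _; rewrite mul0mx.
- by move=> a x1 x2 H1 H2 g fg; rewrite mulmxDl -scalemxAl H1 // H2.
- move=> h x1 hW H1 g fg; have fs := fin_shift h.2 fg.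
  by rewrite -mulmxA -rM // wmul_lampC rM // mulmxA H1.
- by move=> g fg; rewrite psiP // psi1 // scale1r.
Qed.

Lemma fixed_rep_base (h : WT q d) : inW h -> r h = r (0, h.2).
Proof.
case: h => f w fW; rewrite -[in LHS]wmul_split rM; [|exact: fW|exact: baseW].
by rewrite fixed_rep_lamp_trivial // mul1mx.
Qed.

(** With the lamps acting trivially, the representation factors through the abelian group Z^d, so a
    common eigenvector spans an invariant line. *)
Lemma fixed_rep_dim1 : n = 1%N.
Proof.
have [|u u0 uA] := @family_common_eigenvector _ _
  (fun A => exists2 h, inW h & A = r h) n_gt0.
  move=> _ _ [h hW ->] [k kW ->].
  by rewrite /comm_mx (fixed_rep_base hW) (fixed_rep_base kW) -!rM // !wmul_base addrC.
have line x : (x <= u)%MS.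
  apply: (irr_full r_irr (S := fun x => (x <= u)%MS) _ _ _ (submx_refl u) u0 x).
  - exact: sub0mx.
  - by move=> a x1 x2 H1 H2; rewrite addmx_sub // scalemx_sub.
  move=> h x1 hW H1; have [|a ua] := uA (r h); first by exists h.
  by rewrite (submx_trans (submxMr (r h) H1)) // ua scalemx_sub.
apply/eqP; rewrite eqn_leq n_gt0 andbT.
have : ((1%:M : 'M[C]_n) <= u)%MS by apply/row_subP => i; apply: line.
by move/mxrankS; rewrite mxrank1 => /leq_trans; apply; apply: rank_leq_row.
Qed.

End FixedRep.

Lemma fixed_rep_character q d n (phi : WT q d -> WT q d) (M : 'M[int]_d)
    (r : WT q d -> 'M[C]_n) :
    is_aut phi -> (forall g, inW g -> (phi g).2 = g.2 *m M) ->
    (forall v f, fin f -> exists2 b, fin b & f = b - tw phi v b) ->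
    irr_unitary_rep (FRep r) -> rep_equiv (rep_twist phi (FRep r)) (FRep r) ->
  exists (e : n = 1%N) (chi : ZD d -> C), [/\
    forall g, inW g -> castmx (e, e) (r g) = (chi g.2)%:M,
    chi 0 = 1, {morph chi : v w / v + w >-> v * w} &
    forall w, chi (w *m (1%:M - M)) = 1].
Proof.
move=> phi_aut phi2 surj r_irr [e [P uP rP]].
have {}rP g : inW g -> P *m r (phi g) = r g *m P.
  by move=> gW; have := rP g gW; rewrite castmx_id.
have n1 := fixed_rep_dim1 phi_aut phi2 surj r_irr uP rP.
have base := fixed_rep_base phi_aut phi2 surj r_irr uP rP.
have rM := r_irr; case: rM => _ rM _ _; rewrite /= in rM.
have r1 := rep1 r_irr.
have baseW w : inW ((0, w) : WT q d) by apply: fin0.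
have phiW h : inW h -> inW (phi h) by case: phi_aut => H _ _ _; apply: H.
subst n; exists erefl, (fun w => r (0, w) 0 0).
have rE w : r (0, w) = (r (0, w) 0 0)%:M := mx11_scalar _.
have chiD v w : r (0, v + w) 0 0 = r (0, v) 0 0 * r (0, w) 0 0.
  by rewrite -wmul_base (rM _ _ (baseW v) (baseW w)) mxE big_ord1.
have chi0 : r (0, 0) 0 0 = 1 by rewrite (r1 : r (0, 0) = _) mxE.
split=> //= [g gW|w]; first by rewrite castmx_id base // -rE.
(* In dimension 1 the intertwiner [P] is a nonzero scalar and cancels, leaving
   [chi (w *m M) = chi w]. *)
have := rP _ (baseW w); rewrite base ?phi2 //=; last exact: phiW.
rewrite [P]mx11_scalar (rE (w *m M)) (rE w) -!scalar_mxM mulrC.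
move=> /(congr1 (fun A : 'M_1 => A 0 0)); rewrite !mxE !eqxx !mulr1n => E.
have P0 : P 0 0 != 0.
  by have : (P : 'M[C]_1) \in unitmx := uP; rewrite unitmxE det_mx11 unitfE.
have EM : r (0, w *m M) 0 0 = r (0, w) 0 0 by apply: (mulIf P0).
have := chiD (w *m (1%:M - M)) (w *m M).
rewrite mulmxBr mulmx1 subrK EM => /esym E1.
have w0 : r (0, w) 0 0 != 0.
  have := chiD w (- w); rewrite subrr chi0 => E0.
  by apply: contra_eq_neq E0 => ->; rewrite mul0r oner_eq0.
by apply: (mulIf w0); rewrite E1 mul1r.
Qed.

(** * The finite quotient of Z^d and its characters *)

Section FiniteQuotient.
Variables (d : nat) (P R S : 'M[int]_d) (m : 'I_d -> nat).
Hypotheses (RS : R *m S = 1%:M) (SR : S *m R = 1%:M) (m_gt0 : forall i, (0 < m i)%N).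
Hypothesis imP : forall y : 'rV_d,
  (exists w, y = w *m P) <-> forall i, (m i %| (y *m S) 0%R i)%Z.
Implicit Types (x y w : ZD d).

(** Indexes both the elements of Z^d modulo the image of [P], by residues, and the characters of
    this quotient, by exponents of roots of unity; this double role equates the two counts. *)
Definition quotient_index := {dffun forall i : 'I_d, 'I_(m i)}.
Implicit Types a b : quotient_index.

Let coordD x y i : ((x + y) *m S) 0 i = (x *m S) 0 i + (y *m S) 0 i.
Proof. by rewrite mulmxDl mxE. Qed.

Let m0 i : (m i)%:Z != 0. Proof. by rewrite -lt0n. Qed.

Lemma exists_residue : exists res : ZD d -> quotient_index,
  (forall x y, res x = res y <-> exists w, x = y + w *m P) /\
  (forall a, exists x, res x = a).
Proof.
have res_lt (y : ZD d) i : (absz (((y *m S) 0%R i) %% (m i))%Z < m i)%N.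
  by rewrite -ltz_nat gez0_abs ?modz_ge0 // ltz_pmod // ltz_nat.
pose res y : quotient_index := [ffun i => Ordinal (res_lt y i)].
have resE y i : (res y i : nat) = absz (((y *m S) 0%R i) %% (m i))%Z by rewrite ffunE.
exists res; split=> [x y|a].
  have -> : (exists w, x = y + w *m P) <-> (exists w, x - y = w *m P).
    by split=> -[w E]; exists w; [rewrite E addrC addKr | rewrite -E addrC subrK].
  rewrite imP; have coordB i : ((x - y) *m S) 0 i = (x *m S) 0 i - (y *m S) 0 i.
    by rewrite mulmxBl !mxE.
  split=> [E i|dvd_xy].
    rewrite coordB -eqz_mod_dvd; apply/eqP.
    have := congr1 (fun a : quotient_index => (a i : nat)%:Z) E.
    by rewrite /= !resE !gez0_abs ?modz_ge0.
  apply/ffunP => i; apply: val_inj; rewrite /= !resE; congr absz.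
  by apply/eqP; rewrite eqz_mod_dvd -coordB.
exists (\row_i (a i : nat)%:Z *m R); apply/ffunP => i; apply: val_inj.
by rewrite /= resE -mulmxA RS mulmx1 mxE modz_small // ltz_nat ltn_ord.
Qed.

Lemma exists_characters : exists ch : quotient_index -> ZD d -> C,
  [/\ injective ch,
      forall a, ch a 0 = 1 /\ {morph ch a : x y / x + y >-> x * y},
      forall a w, ch a (w *m P) = 1,
      forall a y, `|ch a y| = 1 &
      forall chi : ZD d -> C, chi 0 = 1 -> {morph chi : x y / x + y >-> x * y} ->
        (forall w, chi (w *m P) = 1) -> exists a, forall y, chi y = ch a y].
Proof.
have /fin_all_exists[z zP] : forall i, exists z : C, (m i).-primitive_root z.
  by move=> i; apply: exists_prim_root.
have z1 i : `|z i| = 1.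
  by apply/eqP; rewrite -(pexpr_eq1 (n := m i)) // -normrX (prim_expr_order (zP i)) normr1.
have z0 i : z i != 0 by rewrite -normr_eq0 z1 oner_eq0.
have zU i k : z i ^+ k \is a GRing.unit by rewrite unitfE expf_neq0.
pose ch (a : quotient_index) (y : ZD d) : C := \prod_i (z i ^+ a i) ^ ((y *m S) 0 i).
pose e i : ZD d := row i R.
have eS i j : (e i *m S) 0 j = (i == j)%:R.
  by rewrite /e -row_mul RS !mxE.
have ch_e a i : ch a (e i) = z i ^+ a i.
  rewrite /ch (bigD1 i) //= eS eqxx expr1z big1 ?mulr1 // => j /negPf ji.
  by rewrite eS eq_sym ji expr0z.
have ch0 a : ch a 0 = 1.
  by rewrite /ch big1 // => i _; rewrite mul0mx mxE expr0z.
have chD a : {morph ch a : x y / x + y >-> x * y}.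
  move=> x y; rewrite /ch -big_split; apply: eq_bigr => i _ /=.
  by rewrite coordD exprzDr.
exists ch; split=> [a b ab|//|a w|a y|chi chi0 chiD chiP].
- apply/ffunP => i; apply: val_inj => /=.
  have /eqP := congr1 (@^~ (e i)) ab; rewrite !ch_e (eq_prim_root_expr (zP i)).
  by rewrite !modn_small // => /eqP.
- rewrite /ch big1 // => i _.
  have /dvdzP[k ->] : (m i %| (w *m P *m S) 0%R i)%Z.
    by move: i; apply/imP; exists w.
  rewrite mulrC -exprz_exp -exprnP -exprM mulnC exprM (prim_expr_order (zP i)).
  by rewrite expr1n exp1rz.
- rewrite /ch normr_prod big1 // => i _.
  have norm1X (t : C) (k : int) : `|t| = 1 -> `|t ^ k| = 1.
    by move=> t1; case: k => k; rewrite /exprz ?normfV normrX t1 expr1n ?invr1.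
  by rewrite norm1X // normrX z1 expr1n.
have chi_neq0 y : chi y != 0.
  have := chiD y (- y); rewrite subrr chi0 => E.
  by apply: contra_eq_neq E => ->; rewrite mul0r oner_eq0.
have chiN y : chi (- y) = (chi y)^-1.
  by apply: (mulfI (chi_neq0 y)); rewrite -chiD subrr chi0 mulfV.
have chiMn y k : chi (y *+ k) = chi y ^+ k.
  by elim: k => [|k IH]; rewrite ?chi0 // mulrS chiD IH exprS.
have chiZ k y : chi (k *: y) = chi y ^ k.
  rewrite -[k]intz scaler_int intz; case: k => k; first exact: chiMn.
  by rewrite NegzE mulrNz chiN -exprnN -chiMn.
(* [m i] times [e i] lies in the image of [P], so [chi (e i)] is an [m i]-th root of unity, hence a
   power of [z i]. *)
have /fin_all_exists[a aP] : forall i, exists k : 'I_(m i), chi (e i) = z i ^+ k.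
  move=> i; have [|k ->] := prim_rootP (zP i) (x := chi (e i)); last by exists k.
  rewrite -chiMn; have [w ->] // : exists w, e i *+ m i = w *m P.
  apply/imP => j; rewrite -scaler_nat -scalemxAl mxE eS.
  by case: eqP => [<-|_]; rewrite ?mulr1 ?mulr0 ?dvdz0 // natz dvdzz.
exists [ffun i => a i] => y.
rewrite /ch -[y in LHS]mulmx1 -SR mulmxA mulmx_sum_row.
rewrite (big_morph chi chiD chi0); apply: eq_bigr => i _.
by rewrite chiZ aP ffunE.
Qed.

End FiniteQuotient.

(** * Comparison of the two counts *)

Lemma fix_dual_eq_fintype q d (phi : WT q d -> WT q d) (I : finType) (rep : I -> frep q d) :
    (forall a, irr_unitary_rep (rep a) /\ rep_equiv (rep_twist phi (rep a)) (rep a)) ->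
    (forall a b, rep_equiv (rep a) (rep b) -> a = b) ->
    (forall rho, irr_unitary_rep rho -> rep_equiv (rep_twist phi rho) rho ->
      exists a, rep_equiv rho (rep a)) ->
  fix_dual_eq phi #|I|.
Proof.
move=> rep_fix rep_inj rep_all.
pose rho0 : frep q d := FRep (fun _ => 0 : 'M[C]_0).
pose s := [seq rep a | a <- enum I].
have sE i (iI : (i < #|I|)%N) : nth rho0 s i = rep (enum_val (Ordinal iI)).
  pose a0 := enum_val (Ordinal iI).
  by rewrite (nth_map a0) -?cardE // [in RHS](enum_val_nth a0).
exists s; split=> [|i iI|i j iI jI|rho irr_rho fix_rho].
- by rewrite size_map -cardE.
- by rewrite (sE _ iI).
- by rewrite (sE _ iI) (sE _ jI) => /rep_inj/enum_val_inj [].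
have [a eq_a] := rep_all rho irr_rho fix_rho.
exists (enum_rank a : nat); first exact: ltn_ord.
by rewrite (sE _ (ltn_ord _)) (_ : Ordinal _ = enum_rank a) ?enum_rankK //; apply: val_inj.
Qed.

Lemma reidemeister_card q d (phi : WT q d -> WT q d) (I : finType)
    (cls : WT q d -> I) K :
    (forall g h, inW g -> inW h -> twconj phi g h <-> cls g = cls h) ->
    (forall a, exists2 g, inW g & cls g = a) ->
  reidemeister_eq phi K -> K = #|I|.
Proof.
move=> clsP cls_surj [s [sK sW s_inj s_all]].
pose c (i : 'I_K) := cls (nth (wone q d) s i).
have c_inj : injective c.
  move=> i j cij; apply/val_inj/(s_inj _ _ (ltn_ord i) (ltn_ord j)).
  exact (proj2 (clsP _ _ (sW i (ltn_ord i)) (sW j (ltn_ord j))) cij).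
have /fin_all_exists[t tP] : forall a : I, exists i, c i = a.
  move=> a; have [g gW <-] := cls_surj a; have [i iK gi] := s_all g gW.
  by exists (Ordinal iK); rewrite (proj1 (clsP _ _ gW (sW i iK)) gi).
apply/eqP; rewrite eqn_leq -{1}(card_ord K) (leq_card _ c_inj) /=.
rewrite -[X in (_ <= X)%N](card_ord K); apply: (leq_card t).
by move=> a b /(congr1 c); rewrite !tP.
Qed.

Section CharacterRep.
Variables (q d : nat) (chi : ZD d -> C).
Hypotheses (chiD : {morph chi : x y / x + y >-> x * y}) (chi1 : forall y, `|chi y| = 1).

Definition character_rep : frep q d := FRep (fun g => (chi g.2)%:M : 'M[C]_1).

Lemma character_rep_irr : irr_unitary_rep character_rep.
Proof.
split=> //= [g h _ _|g _|U _].
- by rewrite chiD scalar_mxM.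
- rewrite /unitary_mx map_scalar_mx tr_scalar_mx -scalar_mxM.
  by rewrite [X in X%:M](_ : _ = 1) // -normCK chi1 expr1n.
- by rewrite -mxrank_eq0 /row_full; case: (\rank U) (rank_leq_row U) => [|[]].
Qed.

End CharacterRep.

Lemma character_rep_equiv q d (chi psi : ZD d -> C) :
  rep_equiv (character_rep q chi) (character_rep q psi) -> chi = psi.
Proof.
move=> [e [P uP EP]]; apply/funext => w.
have P0 : P 0 0 != 0 by have : (P : 'M[C]_1) \in unitmx := uP; rewrite unitmxE det_mx11 unitfE.
have /= := EP (0, w) (@fin0 q d); rewrite castmx_id mul_mx_scalar mul_scalar_mx.
by move=> /(congr1 (fun A : 'M_1 => A 0 0)); rewrite !mxE => /(mulIf P0).
Qed.

Lemma TBFT_f_wreath q d : (0 < q)%N -> (0 < d)%N -> TBFT_f q d.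
Proof.
move=> q_gt0 d_gt0 phi phi_aut K hR.
have [M [N [MN NM phi2]]] := aut_base q_gt0 phi_aut.
have det0 := det_base_neq0 phi_aut phi2 hR.
have [m [R [S [RS SR m_gt0 imP]]]] := smith_image det0.
have [res [resP res_surj]] := exists_residue RS m_gt0 imP.
have -> : K = #|{: quotient_index m}|.
  apply: (reidemeister_card (cls := fun g => res g.2) _ _ hR) => [g h gW hW|a].
    rewrite resP; exact: (twconjE q_gt0 phi_aut MN NM phi2 hR d_gt0 gW hW).
  by have [x <-] := res_surj a; exists (0, x) => //; apply: fin0.
have [ch [ch_inj chD chP ch_norm ch_all]] := exists_characters RS SR m_gt0 imP.
apply: (@fix_dual_eq_fintype _ _ _ _ (fun a => character_rep q (ch a))).
- move=> a; have [ch0 chDa] := chD a; split.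
    by apply: character_rep_irr.
  exists erefl, 1%:M; first exact: unitmx1.
  move=> g gW /=; rewrite castmx_id mul1mx mulmx1 phi2 //; congr (_%:M).
  have {2}-> : g.2 = g.2 *m M + g.2 *m (1%:M - M) by rewrite mulmxBr mulmx1 addrC subrK.
  by rewrite chDa chP mulr1.
- by move=> a b /character_rep_equiv/ch_inj.
case=> n r r_irr r_fix.
have surj := lamp_surj q_gt0 phi_aut MN NM phi2 hR d_gt0.
have [e [chi [rE chi0 chiD chiP]]] := fixed_rep_character phi_aut phi2 surj r_irr r_fix.
have [a chiE] := ch_all chi chi0 chiD chiP.
exists a, e, 1%:M; first exact: unitmx1.
by move=> g gW /=; rewrite mul1mx mulmx1 rE // chiE.
Qed.

Local Close Scope ring_scope.

Theorem theorem5p2 (k : nat) (hk : (0 < k)%N) :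
  (forall n : nat, (0 < n)%N -> gcdn n 2 = 1%N -> TBFT_f (3 * n) (2 * k)) /\
  (forall n : nat, (0 < n)%N -> gcdn n 6 = 1%N -> TBFT_f n k).
Proof.
by split=> n n_gt0 _; apply: TBFT_f_wreath; rewrite ?muln_gt0.
Qed.
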